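(* Let $\mathcal{V}$ be a finite vertex set with a partition into nonempty sets $\mathcal{C}^\star_1,\dots,\mathcal{C}^\star_{k^\star}$, and let $G$ be a random planted clique cover instance defined on these cliques, where edges between cliques are introduced with probability $$p < c:=\min\left\{\frac14\left(\frac{\min_l 1/|\mathcal{C}^\star_l|}{\sum_{l} 1/|\mathcal{C}^\star_l|}\right)^2,\ \frac{1}{100}\right\}.$$ Then $(A^\star,k^\star)$ (that is, $A=A^\star$, $t=k^\star$) is the unique optimal solution of the Lovász theta program (P) of $G$ with probability greater than $$1-\sum_{i=1}^{k^\star}|\mathcal{C}^\star_i|\sum_{j\ne i}\exp\left(-2|\mathcal{C}^\star_j|(c-p)^2\right).$$
   Context: Planted clique cover instance: given $\mathcal{V}$, the partition $\{\mathcal{C}^\star_l\}_{l=1}^{k^\star}$ and a parameter $p\in[0,1]$, the random simple undirected graph $G=(\mathcal{V},\mathcal{E})$ is obtained by making every $\mathcal{C}^\star_l$ a clique (all pairs of distinct vertices inside $\mathcal{C}^\star_l$ are edges), and by including each edge between two vertices belonging to different sets of the partition with probability $p$, independently over all such pairs. Lovász theta program (P) of $G=(\mathcal{V},\mathcal{E})$: minimize $t$ over pairs $(t,A)$ with $t\in\mathbb{R}$ and $A$ a real symmetric $|\mathcal{V}|\times|\mathcal{V}|$ matrix, subject to $tI+A-J\succeq 0$, $A_{i,i}=0$ for all $i$, and $A_{i,j}=0$ for all $(i,j)\notin\mathcal{E}$. Here $J$ is the all-ones matrix and $I$ the identity matrix. $A^\star := \sum_{l=1}^{k^\star} k^\star\,\mathbf{1}_{\mathcal{C}^\star_l}\mathbf{1}_{\mathcal{C}^\star_l}^T-k^\star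 I$, where $\mathbf{1}_{\mathcal{C}}\in\mathbb{R}^{|\mathcal{V}|}$ is the 0/1 indicator vector of $\mathcal{C}\subset\mathcal{V}$.
   Formalization: When there is only one clique (k* = 1) the sum is empty and the claimed bound ''probability greater than 1'' is impossible; in that case the theorem proves probability at least 1 instead, and for k* ≥ 2 the inequality is strict as stated. *)

(* Defs.v *)
From HB Require Import structures.
From mathcomp Require Import all_boot all_order all_algebra.
From mathcomp Require Import boolp reals sequences exp.

Set Implicit Arguments.
Unset Strict Implicit.
Unset Printing Implicit Defensive.

Import Order.TTheory GRing.Theory Num.Theory.
Local Open Scope ring_scope.

(* A simple graph on the vertex set 'I_n is given by its edge set
   E : {set {set 'I_n}}, an edge being a 2-element set of vertices.
   A clique cover is Cs : {set {set 'I_n}} with partition Cs [set: 'I_n]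
   (so the cliques are nonempty), and k* is #|Cs|. *)

(* The three cases are: not a pair of distinct vertices; a pair inside one
   clique; a pair between two cliques. *)
Definition edge_prob (R : realType) (n : nat) (Cs : {set {set 'I_n}}) (p : R)
    (e : {set 'I_n}) : R :=
  if #|e| != 2 then 0
  else if [exists C in Cs, e \subset C] then 1
  else p.

(* Each e is an edge with probability edge_prob Cs p e, independently. *)
Definition planted_law (R : realType) (n : nat) (Cs : {set {set 'I_n}}) (p : R)
    (E : {set {set 'I_n}}) : R :=
  \prod_(e : {set 'I_n})
     (if e \in E then edge_prob Cs p e else 1 - edge_prob Cs p e).

Definition planted_prob (R : realType) (n : nat) (Cs : {set {set 'I_n}}) (p : R)
    (Q : {set {set 'I_n}} -> Prop) : R :=
  \sum_(E : {set {set 'I_n}} | `[< Q E >]) planted_law Cs p E.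

(* Taking F empty shows that the total mass is 1; the general case says that
   the events e \in E are mutually independent with the marginals edge_prob. *)
Lemma planted_prob_sub (R : realType) (n : nat) (Cs : {set {set 'I_n}}) (p : R)
    (F : {set {set 'I_n}}) :
  planted_prob Cs p (fun E => F \subset E) = \prod_(e in F) edge_prob Cs p e.
Proof.
set q := edge_prob Cs p.
transitivity (\prod_(e : {set 'I_n})
    (q e + (if e \in F then 0 else 1 - q e))); last first.
  rewrite (bigID (mem F)) /= [X in _ * X]big1 ?mulr1.
    by apply: eq_bigr => e ->; rewrite addr0.
  by move=> e /negPf ->; rewrite addrC subrK.
rewrite bigA_distr /planted_prob /planted_law big_mkcond /=.
apply: eq_bigr => E _; rewrite asboolb; case: ifPn => [/subsetP sFE|].
  apply: eq_bigr => e _; case: ifPn => // eE.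
  by rewrite ifN //; apply: contra eE => /sFE.
case/subsetPn=> e eF /negPf eE.
by rewrite (bigD1 e) //= eE eF mul0r.
Qed.

Definition psd (R : realType) (n : nat) (M : 'M[R]_n) : Prop :=
  M^T = M /\ forall x : 'cV[R]_n, 0 <= (x^T *m M *m x) 0 0.

Definition theta_feasible (R : realType) (n : nat) (E : {set {set 'I_n}})
    (t : R) (A : 'M[R]_n) : Prop :=
  [/\ A^T = A,
      psd (t%:M + A - const_mx 1),
      forall i, A i i = 0
    & forall i j, [set i; j] \notin E -> A i j = 0].

Definition theta_optimal (R : realType) (n : nat) (E : {set {set 'I_n}})
    (t : R) (A : 'M[R]_n) : Prop :=
  theta_feasible E t A /\ forall t' A', theta_feasible E t' A' -> t <= t'.

Definition theta_unique_optimal (R : realType) (n : nat) (E : {set {set 'I_n}})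
    (t : R) (A : 'M[R]_n) : Prop :=
  theta_optimal E t A /\
  forall t' A', theta_optimal E t' A' -> t' = t /\ A' = A.

Definition ind_cv (R : realType) (n : nat) (C : {set 'I_n}) : 'cV[R]_n :=
  \col_i (i \in C)%:R.

Definition A_star (R : realType) (n : nat) (Cs : {set {set 'I_n}}) : 'M[R]_n :=
  \sum_(C in Cs) #|Cs|%:R *: (ind_cv R C *m (ind_cv R C)^T) - #|Cs|%:R%:M.

(* The default 1 of the iterated minimum is immaterial when Cs is nonempty and
   consists of nonempty sets, because then every #|C|%:R^-1 is at most 1. *)
Definition cover_threshold (R : realType) (n : nat) (Cs : {set {set 'I_n}}) : R :=
  Num.min
    (4^-1 * ((\big[Num.min/1]_(C in Cs) #|C|%:R^-1)
              / (\sum_(C in Cs) #|C|%:R^-1)) ^+ 2)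
    (100^-1).

(* Main.v *)
(* Let k be the number of cliques, w_i the inverse size of the clique of i, and
   for a feasible (t, A) put M = tI + A - J and
   f(i, j) = M_ii + M_jj - 2 M_ij >= 0, the value of the form M at e_i - e_j.
   Positivity of M at the vector w reads
     0 <= k (t - k) - (1/2) sum_{i,j in one clique} w_i^2 f(i, j)
          + sum_{i,j in two cliques} w_i w_j A_ij.
   If ij is an edge between two cliques and a, b lie in the cliques of i, j with
   ib, aj, ab non-edges, then positivity of M at e_i - e_a - e_j + e_b gives
   2 A_ij <= f(i, a) + f(j, b).  When every vertex has few neighbours in every
   other clique, averaging over a and b bounds the last sum by half of the
   middle one, so t >= k; at t = k all f(i, j) inside cliques vanish, which
   forces A = A*.  Such sparsity fails with small probability by a Chernoff bound
   and a union bound. *)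

Require Import Defs.
From mathcomp Require Import all_boot all_order all_algebra.
From mathcomp Require Import boolp reals sequences exp.
From mathcomp Require Import ring lra.

Set Implicit Arguments.
Unset Strict Implicit.
Unset Printing Implicit Defensive.

Import Order.TTheory GRing.Theory Num.Theory.
Local Open Scope ring_scope.

(** * Positive semidefinite forms and squared distances *)

(** When [M] is the Gram matrix of vectors [v_i], this is [|v_i - v_j|^2]. *)
Definition dist2 (R : realType) (n : nat) (M : 'M[R]_n) (i j : 'I_n) : R :=
  M i i + M j j - 2 * M i j.

Lemma quad_formE (R : realType) (n : nat) (M : 'M[R]_n) (x : 'cV[R]_n) :
  (x^T *m M *m x) 0 0 = \sum_i \sum_j x i 0 * x j 0 * M i j.
Proof.
rewrite mxE exchange_big /=; apply: eq_bigr => j _.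
by rewrite mxE mulr_suml; apply: eq_bigr => i _; rewrite mxE mulrAC.
Qed.

Lemma psd_sum_ge0 (R : realType) (n : nat) (M : 'M[R]_n) (x : 'I_n -> R) :
  psd M -> 0 <= \sum_i \sum_j x i * x j * M i j.
Proof.
case=> _ /(_ (\col_i x i)); rewrite quad_formE.
by under eq_bigr do under eq_bigr do rewrite !mxE.
Qed.

Lemma psd_sym (R : realType) (n : nat) (M : 'M[R]_n) (i j : 'I_n) :
  psd M -> M i j = M j i.
Proof. by case=> sM _; rewrite -{1}sM mxE. Qed.

(** In Gram vectors this reads [2 <u, v> <= |u|^2 + |v|^2] with [u = v_a - v_b] and [v = v_c - v_d],
    that is, [|u - v|^2 >= 0]. *)
Lemma psd_four_point (R : realType) (n : nat) (M : 'M[R]_n)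
    (a b c d : 'I_n) :
  psd M -> 2 * (M a c - M a d - M b c + M b d) <= dist2 M a b + dist2 M c d.
Proof.
move=> pM; pose e (i : 'I_n) : 'cV[R]_n := delta_mx i 0.
pose B (x y : 'cV[R]_n) := (x^T *m M *m y) 0 0.
have Be i j : B (e i) (e j) = M i j.
  by rewrite /B trmx_delta -rowE -colE !mxE.
have Bl x y z : B (x - y) z = B x z - B y z.
  by rewrite /B linearB /= !mulmxBl !mxE.
have Br x y z : B z (x - y) = B z x - B z y.
  by rewrite /B mulmxBr !mxE.
case: (pM) => _ /(_ (e a - e b - (e c - e d))).
rewrite -/(B _ _) !(Bl, Br) !Be /dist2.
rewrite [M b a](psd_sym _ _ pM) [M c a](psd_sym _ _ pM) [M c b](psd_sym _ _ pM).
rewrite [M d a](psd_sym _ _ pM) [M d b](psd_sym _ _ pM) [M d c](psd_sym _ _ pM).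
lra.
Qed.

Lemma psd_dist2_ge0 (R : realType) (n : nat) (M : 'M[R]_n) (a b : 'I_n) :
  psd M -> 0 <= dist2 M a b.
Proof. by move=> pM; have := psd_four_point a b a a pM; rewrite /dist2; lra. Qed.

(** * Weights, spreads and sparsity of a clique cover *)

(** For a partition every clique has total weight 1, so this vector lies in the kernel of
    [k I + A_star - J]; testing positivity at it loses nothing at the optimum. *)
Definition weight (R : realType) (n : nat) (Cs : {set {set 'I_n}}) (i : 'I_n) : R :=
  #|pblock Cs i|%:R^-1.

Definition spread (R : realType) (n : nat) (Cs : {set {set 'I_n}}) (M : 'M[R]_n)
    (i : 'I_n) : R :=
  \sum_(j in pblock Cs i) dist2 M i j.

Definition sparse_cover (R : realType) (n : nat) (Cs E : {set {set 'I_n}}) (c : R) :=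
  forall (i : 'I_n) (D : {set 'I_n}), D \in Cs -> i \notin D ->
    #|[set j in D | [set i; j] \in E]|%:R <= c * #|D|%:R.

(** * Blocks of the partition, and positivity tested at the weight vector *)

Section Cover.

Context {R : realType} {n : nat} {Cs : {set {set 'I_n}}}.
Hypothesis hCs : partition Cs [set: 'I_n].

Local Notation w := (weight R Cs).
Local Notation k := (#|Cs|%:R : R).

Let trivCs : trivIset Cs. Proof. by case/and3P: hCs. Qed.

Lemma in_cover_partition i : i \in cover Cs.
Proof. by case/and3P: hCs => /eqP ->. Qed.

Lemma mem_own_block i : i \in pblock Cs i.
Proof. by rewrite mem_pblock in_cover_partition. Qed.

Lemma own_block_in i : pblock Cs i \in Cs.
Proof. exact/pblock_mem/in_cover_partition. Qed.

Lemma same_block_sym i j : (i \in pblock Cs j) = (j \in pblock Cs i).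
Proof. by rewrite -!eq_pblock ?in_cover_partition // eq_sym. Qed.

Lemma card_block_gt0 C : C \in Cs -> 0 < (#|C|%:R : R).
Proof.
case/and3P: hCs => _ _ n0 CC; rewrite ltr0n card_gt0.
by apply: contraNneq n0 => <-.
Qed.

Lemma weight_gt0 i : 0 < w i.
Proof. by rewrite invr_gt0 card_block_gt0 ?own_block_in. Qed.

Lemma weight_ge0 i : 0 <= w i.
Proof. exact/ltW/weight_gt0. Qed.

Lemma weight_same i j : j \in pblock Cs i -> w j = w i.
Proof. by move=> ij; rewrite /weight (same_pblock trivCs ij). Qed.

Lemma weight_block C j : C \in Cs -> j \in C -> w j = #|C|%:R^-1.
Proof. by move=> CC jC; rewrite /weight (def_pblock trivCs CC jC). Qed.

Lemma sum_weight_block C : C \in Cs -> \sum_(j in C) w j = 1.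
Proof.
move=> CC; rewrite (eq_bigr (fun=> #|C|%:R^-1)); last first.
  by move=> j; apply: weight_block.
by rewrite sumr_const -[_ *+ _]mulr_natr mulVf // gt_eqF // card_block_gt0.
Qed.

Lemma sum_over_blocks (F : 'I_n -> R) : \sum_i F i = \sum_(C in Cs) \sum_(i in C) F i.
Proof. by rewrite -(set_partition_big _ hCs); apply: eq_bigl => i; rewrite inE. Qed.

Lemma sum_weight : \sum_i w i = k.
Proof.
by rewrite sum_over_blocks (eq_bigr (fun=> 1)) ?sumr_const // => C /sum_weight_block.
Qed.

Lemma sum_weight_cross :
  \sum_i \sum_(j | j \notin pblock Cs i) w i * w j = k ^+ 2 - k.
Proof.
transitivity (\sum_i (w i * k - w i)).
  apply: eq_bigr => i _; rewrite -mulr_sumr -sum_weight.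
  rewrite [X in _ = w i * X - _](bigID (mem (pblock Cs i))) /=.
  by rewrite sum_weight_block ?own_block_in //; ring.
by rewrite sumrB -mulr_suml sum_weight expr2.
Qed.

(** The form at [w] is split into pairs inside one clique and pairs across. Inside a clique [w] is
    constant, and the constant diagonal gives [M i j = d - dist2 M i j / 2]. *)
Lemma psd_block_average (M : 'M[R]_n) (d : R) :
  psd M -> (forall i, M i i = d) ->
  0 <= k * d - 2^-1 * (\sum_i w i ^+ 2 * spread Cs M i)
       + \sum_i \sum_(j | j \notin pblock Cs i) w i * w j * M i j.
Proof.
move=> pM Md; apply: le_trans (psd_sum_ge0 w pM) _.
rewrite -sum_weight mulr_suml mulr_sumr -sumrB -big_split /= ler_sum // => i _.
rewrite (bigID (mem (pblock Cs i))) /= lerD2r le_eqVlt; apply/orP; left; apply/eqP.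
rewrite (eq_bigr (fun j => w i * (w j * d) - 2^-1 * (w i ^+ 2 * dist2 M i j))).
  by rewrite sumrB -!mulr_sumr -mulr_suml sum_weight_block ?own_block_in ?mul1r.
by move=> j ij; rewrite (weight_same ij) /dist2 !Md; field.
Qed.

(** The diagonal [t - 1] contributes [k (t - 1)], and the entries [-1] of [-J] across cliques
    contribute [-(k^2 - k)]; together they make [k (t - k)]. *)
Lemma theta_slack (E : {set {set 'I_n}}) (t : R) (A : 'M[R]_n) :
  theta_feasible E t A ->
  0 <= k * (t - k)
       - 2^-1 * (\sum_i w i ^+ 2 * spread Cs (t%:M + A - const_mx 1) i)
       + \sum_i \sum_(j | j \notin pblock Cs i) w i * w j * A i j.
Proof.
case=> _ pM dA _.
have dM i : (t%:M + A - const_mx 1) i i = t - 1 by rewrite !mxE eqxx dA addr0.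
have := psd_block_average pM dM; congr (_ <= _).
have -> : \sum_i \sum_(j | j \notin pblock Cs i) w i * w j * (t%:M + A - const_mx 1) i j
   = \sum_i \sum_(j | j \notin pblock Cs i) w i * w j * A i j - (k ^+ 2 - k).
  rewrite -sum_weight_cross -sumrB; apply: eq_bigr => i _.
  rewrite -sumrB; apply: eq_bigr => j ij.
  have /negPf ne : i != j by apply: contraNneq ij => <-; exact: mem_own_block.
  by rewrite !mxE ne mulr0n; ring.
ring.
Qed.

Lemma cross_block i j a b :
  a \in pblock Cs i -> b \in pblock Cs j -> (b \in pblock Cs a) = (j \in pblock Cs i).
Proof.
move=> /(same_pblock trivCs) ai /(same_pblock trivCs) bj.
by rewrite -!eq_pblock ?in_cover_partition // ai bj.
Qed.

Lemma notin_block_neq i j : j \notin pblock Cs i -> i != j.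
Proof. by apply: contraNneq => <-; exact: mem_own_block. Qed.

(** * Entries between cliques bounded by spreads inside cliques *)

Section Sparse.

Context {E : {set {set 'I_n}}} {c t : R} {A : 'M[R]_n}.
Hypothesis sparseE : sparse_cover Cs E c.
Hypothesis feasA : theta_feasible E t A.

Local Notation M := (t%:M + A - const_mx 1).
Local Notation e i j := (([set i; j] \in E)%:R : R).

Let psdM : psd M. Proof. by case: feasA. Qed.

Lemma spread_ge0 i : 0 <= spread Cs M i.
Proof. by apply: sumr_ge0 => j _; apply: psd_dist2_ge0. Qed.

Lemma cross_entryE i j : j \notin pblock Cs i -> M i j = A i j - 1.
Proof. by move=> /notin_block_neq /negPf ne; rewrite !mxE ne mulr0n add0r. Qed.

(** The factor encodes a case distinction in a form that can be averaged. If the three pairs are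
    non-edges it is 1, and the four-point inequality applies, the shifts by [-1] cancelling.
    Otherwise it is at most 0, and so is the left side because [0 <= A i j]. *)
Lemma cross_entry_rectangle i j a b :
  j \notin pblock Cs i -> a \in pblock Cs i -> b \in pblock Cs j -> 0 <= A i j ->
  (1 - e i b - e j a - e a b) * (2 * A i j) <= dist2 M i a + dist2 M j b.
Proof.
move=> ij ai bj Aij; case: feasA => _ _ _ A0.
have le0 (x : R) : x <= 0 -> x * (2 * A i j) <= dist2 M i a + dist2 M j b.
  move=> x0; apply: (@le_trans _ _ 0); last by rewrite addr_ge0 ?psd_dist2_ge0.
  by rewrite mulr_le0_ge0 // mulr_ge0.
have e0 x y : 0 <= e x y by exact: ler0n.
have [_|ib] := boolP ([set i; b] \in E).
  by apply: le0 => /=; have := e0 j a; have := e0 a b; lra.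
have [_|ja] := boolP ([set j; a] \in E).
  by apply: le0 => /=; have := e0 a b; lra.
have [_|ab] := boolP ([set a; b] \in E); first by apply: le0 => /=; lra.
have := psd_four_point i a j b psdM.
rewrite !cross_entryE ?(cross_block ai bj) ?(cross_block (mem_own_block i) bj)
  ?(cross_block ai (mem_own_block j)) //.
rewrite [A i b]A0 // [A a j]A0 1?setUC // [A a b]A0 //=; lra.
Qed.

Lemma sparse_sum_block i D : D \in Cs -> i \notin D -> \sum_(j in D) w j * e i j <= c.
Proof.
move=> DC iD; rewrite (eq_bigr (fun j => #|D|%:R^-1 * e i j)); last first.
  by move=> j jD; rewrite (weight_block DC jD).
rewrite -mulr_sumr ler_pdivrMl ?card_block_gt0 // mulrC.
apply: le_trans (sparseE DC iD); rewrite -natr_sum ler_nat -sum1_card.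
rewrite [leqRHS]big_mkcond [leqLHS]big_mkcond leq_sum //= => j _.
by rewrite inE; case: (j \in D); case: (_ \in E).
Qed.

(** The rectangle inequality is averaged over [a] and [b] with the clique weights. By sparsity each
    of the three edge indicators averages to at most [c]. *)
Lemma cross_entry_le i j :
  c <= 100^-1 -> j \notin pblock Cs i ->
  A i j <= e i j * (w i * spread Cs M i + w j * spread Cs M j).
Proof.
move=> c100 ij; have [eij|eij] := boolP ([set i; j] \in E); last first.
  by case: feasA => _ _ _ ->; rewrite ?mul0r.
rewrite mul1r.
have wS x : 0 <= w x * spread Cs M x by rewrite mulr_ge0 ?spread_ge0 ?weight_ge0.
have [A0|/ltW A0] := leP (A i j) 0; first by rewrite (le_trans A0) // addr_ge0.
have ji : i \notin pblock Cs j by rewrite same_block_sym.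
have wE x : w x * spread Cs M x = \sum_(a in pblock Cs x) w a * dist2 M x a.
  by rewrite mulr_sumr; apply: eq_bigr => a /weight_same ->.
have w1 x : \sum_(a in pblock Cs x) w a = 1 by rewrite sum_weight_block ?own_block_in.
have : \sum_(a in pblock Cs i) \sum_(b in pblock Cs j)
         w a * w b * ((1 - e i b - e j a - e a b) * (2 * A i j))
     <= \sum_(a in pblock Cs i) \sum_(b in pblock Cs j)
         w a * w b * (dist2 M i a + dist2 M j b).
  apply: ler_sum => a ai; apply: ler_sum => b bj.
  by rewrite ler_wpM2l ?cross_entry_rectangle // mulr_ge0 ?weight_ge0.
have -> : \sum_(a in pblock Cs i) \sum_(b in pblock Cs j)
         w a * w b * (dist2 M i a + dist2 M j b)
     = w i * spread Cs M i + w j * spread Cs M j.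
  rewrite !wE -[X in _ = _ + X]mul1r -(w1 i) mulr_suml -big_split /=.
  apply: eq_bigr => a _; rewrite mulr_sumr -[X in _ = X + _]mulr1 -(w1 j).
  by rewrite mulr_sumr -big_split /=; apply: eq_bigr => b _; ring.
apply: le_trans.
(* Here [2 (1 - 3 c) >= 1], for which [c <= 1/6] would suffice. *)
apply: (@le_trans _ _ ((1 - 3 * c) * (2 * A i j))); first by nra.
have -> : \sum_(a in pblock Cs i) \sum_(b in pblock Cs j)
         w a * w b * ((1 - e i b - e j a - e a b) * (2 * A i j))
  = (\sum_(a in pblock Cs i) w a * (1 - \sum_(b in pblock Cs j) w b * e i b
        - e j a - \sum_(b in pblock Cs j) w b * e a b)) * (2 * A i j).
  rewrite mulr_suml; apply: eq_bigr => a _.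
  pose K := w a * (2 * A i j).
  rewrite (eq_bigr (fun b => K * (1 - e j a) * w b - K * (w b * e i b)
                             - K * (w b * e a b))); last by move=> b _; rewrite /K; ring.
  by rewrite !sumrB -!mulr_sumr w1 /K; ring.
rewrite ler_wpM2r ?mulr_ge0 //.
(* For fixed [a] the indicators of [ib] and [ab] are averaged over [b]; that of [ja] is left for the
   average over [a]. *)
apply: (@le_trans _ _ (\sum_(a in pblock Cs i) w a * (1 - c - c - e j a))); last first.
  apply: ler_sum => a ai; rewrite ler_wpM2l ?weight_ge0 //.
  have := sparse_sum_block (own_block_in j) ji.
  have aj : a \notin pblock Cs j.
    by rewrite same_block_sym (cross_block ai (mem_own_block j)).
  have := sparse_sum_block (own_block_in j) aj; lra.
have -> : \sum_(a in pblock Cs i) w a * (1 - c - c - e j a)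
   = 1 - c - c - \sum_(a in pblock Cs i) w a * e j a.
  rewrite -[X in _ = X - _]mul1r -(w1 i) mulr_suml -sumrB.
  by apply: eq_bigr => a _; ring.
have := sparse_sum_block (own_block_in i) ij; lra.
Qed.

(** Each foreign clique contributes at most [c]; the clique of [i] contributes 0, within the same
    allowance since [0 <= c]. *)
Lemma sparse_sum_cross i : 0 <= c -> \sum_(j | j \notin pblock Cs i) w j * e i j <= c * k.
Proof.
move=> c0; rewrite big_mkcond /= sum_over_blocks -sumr_const mulr_sumr ler_sum //.
move=> D DC; rewrite mulr1; have [iD|iD] := boolP (i \in D).
  by rewrite big1 // => j jD; rewrite (def_pblock trivCs DC iD) jD.
rewrite -big_mkcondr /=; apply: le_trans (sparse_sum_block DC iD).
rewrite [leRHS]big_mkcond [leLHS]big_mkcond ler_sum //= => j _.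
case: (j \in D) => //=; case: (_ \notin _) => //.
by rewrite mulr_ge0 ?ler0n // weight_ge0.
Qed.

Lemma cross_sum_le :
  0 <= c <= 100^-1 ->
  \sum_i \sum_(j | j \notin pblock Cs i) w i * w j * A i j
    <= 2 * (c * k) * \sum_i w i ^+ 2 * spread Cs M i.
Proof.
case/andP=> c0 c100.
have bound : \sum_i \sum_(j | j \notin pblock Cs i)
     w i * w j * e i j * (w i * spread Cs M i) <= c * k * \sum_i w i ^+ 2 * spread Cs M i.
  rewrite mulr_sumr ler_sum // => i _.
  have -> : \sum_(j | j \notin pblock Cs i) w i * w j * e i j * (w i * spread Cs M i)
     = (\sum_(j | j \notin pblock Cs i) w j * e i j) * (w i ^+ 2 * spread Cs M i).
    by rewrite mulr_suml; apply: eq_bigr => j _; ring.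
  by rewrite ler_wpM2r ?sparse_sum_cross // mulr_ge0 ?sqr_ge0 ?spread_ge0.
apply: le_trans (_ : _ <= \sum_i \sum_(j | j \notin pblock Cs i)
     w i * w j * e i j * (w i * spread Cs M i) + \sum_i \sum_(j | j \notin pblock Cs i)
     w i * w j * e i j * (w j * spread Cs M j)) _.
  rewrite -big_split ler_sum //= => i _; rewrite -big_split ler_sum //= => j ij.
  rewrite -mulrDr -[_ * _ * e i j * _]mulrA ler_wpM2l ?cross_entry_le //.
  by rewrite mulr_ge0 ?weight_ge0.
(* Exchanging [i] and [j] shows that both halves of the bound are equal, whence the factor 2. *)
have -> : \sum_i \sum_(j | j \notin pblock Cs i) w i * w j * e i j * (w j * spread Cs M j)
   = \sum_i \sum_(j | j \notin pblock Cs i) w i * w j * e i j * (w i * spread Cs M i).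
  rewrite (exchange_big_dep predT) //=; apply: eq_bigr => i _.
  by apply: eq_big => [j|j _]; rewrite 1?same_block_sym // setUC; ring.
lra.
Qed.

(** The cross terms cost at most [2 c k <= 1/4] of the weighted spread sum, while the slack
    inequality provides [1/2] of it. *)
Lemma theta_gap :
  0 <= c <= 100^-1 -> c * k <= 8^-1 ->
  4^-1 * (\sum_i w i ^+ 2 * spread Cs M i) <= k * (t - k).
Proof.
move=> hc ck; have := theta_slack feasA; have := cross_sum_le hc.
have : 0 <= \sum_i w i ^+ 2 * spread Cs M i.
  by apply: sumr_ge0 => i _; rewrite mulr_ge0 ?sqr_ge0 ?spread_ge0.
nra.
Qed.

End Sparse.

(** * Feasibility of [A_star] *)

Lemma A_starE i j : A_star R Cs i j = if (j \in pblock Cs i) && (i != j) then k else 0.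
Proof.
rewrite !mxE summxE (bigD1 (pblock Cs i)) ?own_block_in //= big1 => [|C /andP[CC Ci]].
  rewrite !mxE big_ord1 !mxE mem_own_block mul1r addr0.
  have [<-|ne] := eqVneq i j; first by rewrite mem_own_block mulr1 mulr1n andbF subrr.
  by rewrite mulr0n subr0 andbT; case: ifP; rewrite ?mulr1 ?mulr0.
rewrite !mxE big_ord1 !mxE; have [iC|] := boolP (i \in C); last by rewrite mul0r mulr0.
by rewrite (def_pblock trivCs CC iC) eqxx in Ci.
Qed.

(** Cauchy-Schwarz against the all-ones vector: the sum of all [(f i - f j)^2] is twice the
    difference of the two sides. *)
Lemma sqr_sum_le (I : finType) (P : {pred I}) (f : I -> R) :
  (\sum_(i in P) f i) ^+ 2 <= #|P|%:R * \sum_(i in P) f i ^+ 2.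
Proof.
have : 0 <= \sum_(i in P) \sum_(j in P) (f i - f j) ^+ 2.
  by apply: sumr_ge0 => i _; apply: sumr_ge0 => j _; apply: sqr_ge0.
have -> : \sum_(i in P) \sum_(j in P) (f i - f j) ^+ 2
    = \sum_(i in P) (#|P|%:R * f i ^+ 2 - 2 * (\sum_(j in P) f j) * f i
                     + \sum_(j in P) f j ^+ 2).
  apply: eq_bigr => i _.
  rewrite (eq_bigr (fun j => f i ^+ 2 - 2 * f i * f j + f j ^+ 2)).
    by rewrite big_split sumrB /= sumr_const -mulr_natr -mulr_sumr; ring.
  by move=> j _; ring.
rewrite big_split sumrB /= sumr_const -[_ *+ _]mulr_natr -!mulr_sumr; nra.
Qed.

(** With [s C] the sum of [x] over the clique [C], the form at [x] is [k] times the sum of the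
    [s C ^+ 2] minus the square of the sum of the [s C]. *)
Lemma psd_A_star : psd (k%:M + A_star R Cs - const_mx 1).
Proof.
have ME i j : (k%:M + A_star R Cs - const_mx 1) i j = k * (j \in pblock Cs i)%:R - 1.
  rewrite 2!mxE mxE A_starE !mxE.
  have [<-|ne] := eqVneq i j; first by rewrite mem_own_block /= addr0 mulr1n mulr1.
  by rewrite andbT mulr0n add0r; case: ifP; rewrite ?mulr1 ?mulr0.
split=> [|x]; first by apply/matrixP => i j; rewrite mxE !ME same_block_sym.
rewrite quad_formE; pose s (C : {set 'I_n}) := \sum_(i in C) x i 0.
have -> : \sum_i \sum_j x i 0 * x j 0 * (k%:M + A_star R Cs - const_mx 1) i j
   = k * (\sum_(C in Cs) s C ^+ 2) - (\sum_(C in Cs) s C) ^+ 2.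
  rewrite -(sum_over_blocks (fun i => x i 0)).
  rewrite (eq_bigr (fun i => k * (x i 0 * s (pblock Cs i)) - x i 0 * \sum_j x j 0)).
    rewrite sumrB -mulr_suml -mulr_sumr -expr2; congr (_ * _ - _).
    rewrite sum_over_blocks; apply: eq_bigr => C CC; rewrite expr2 /s mulr_suml; apply: eq_bigr => i iC.
    by rewrite (def_pblock trivCs CC iC).
  move=> i _; rewrite /s [in RHS]big_mkcond /= !mulr_sumr -sumrB.
  by apply: eq_bigr => j _; rewrite ME; case: ifP => _; rewrite /=; ring.
by rewrite subr_ge0; exact: sqr_sum_le.
Qed.

Lemma theta_feasible_A_star (E : {set {set 'I_n}}) :
  (forall i j, i != j -> j \in pblock Cs i -> [set i; j] \in E) ->
  theta_feasible E k (A_star R Cs).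
Proof.
move=> clE; split; [| exact: psd_A_star | by move=> i; rewrite A_starE eqxx andbF |].
  by apply/matrixP => i j; rewrite mxE !A_starE same_block_sym eq_sym.
by move=> i j ijE; rewrite A_starE; case: ifP => // /andP[ij ne]; rewrite clE in ijE.
Qed.

(** * Deterministic optimality and uniqueness for sparse covers *)

Theorem sparse_cover_unique_optimal (E : {set {set 'I_n}}) (c : R) :
  (0 < #|Cs|)%N ->
  (forall i j, i != j -> j \in pblock Cs i -> [set i; j] \in E) ->
  sparse_cover Cs E c -> 0 <= c <= 100^-1 -> c * k <= 8^-1 ->
  theta_unique_optimal E k (A_star R Cs).
Proof.
move=> k0 clE spE hc ck; have {}k0 : 0 < k by rewrite ltr0n.
have fE := theta_feasible_A_star clE.
have term_ge0 t A i : theta_feasible E t A ->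
    0 <= w i ^+ 2 * spread Cs (t%:M + A - const_mx 1) i.
  by move=> fA; rewrite mulr_ge0 ?sqr_ge0 ?(spread_ge0 fA).
have opt t A : theta_feasible E t A -> k <= t.
  move=> fA; have := theta_gap spE fA hc ck.
  have : 0 <= \sum_i w i ^+ 2 * spread Cs (t%:M + A - const_mx 1) i.
    by apply: sumr_ge0 => i _; apply: term_ge0.
  by move=> S0 gap; rewrite -subr_ge0 -(pmulr_rge0 _ k0); lra.
split=> [|t A [fA /(_ _ _ fE) tk]]; first by split=> // t A /opt.
have {tk} tk : t = k by apply/eqP; rewrite eq_le tk (opt _ _ fA).
subst t; split=> //; pose M := k%:M + A - const_mx 1.
have [_ pM dA _] := fA.
have S0 : \sum_i w i ^+ 2 * spread Cs M i = 0.
  apply/eqP; rewrite eq_le sumr_ge0 => [|i _]; last exact: term_ge0.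
  by have := theta_gap spE fA hc ck; rewrite -/M; lra.
have spread0 i : spread Cs M i = 0.
  have /eqP := psumr_eq0P (fun i _ => term_ge0 _ _ i fA) S0 (i := i) isT.
  by rewrite mulf_eq0 expf_eq0 /= gt_eqF ?weight_gt0 //= => /eqP.
(* With all spreads zero, entries across cliques are at most 0; the slack inequality makes their
   weighted sum nonnegative, so they all vanish. *)
have Ax i j : j \notin pblock Cs i -> A i j <= 0.
  case/andP: hc => _ hc ij.
  by have := cross_entry_le spE fA hc ij; rewrite -/M !spread0 !mulr0 addr0 mulr0.
have row_ge0 i : 0 <= - \sum_(j | j \notin pblock Cs i) w i * w j * A i j.
  by rewrite -sumrN sumr_ge0 // => j ij; rewrite oppr_ge0 mulr_ge0_le0 ?mulr_ge0 ?weight_ge0 ?Ax.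
have cross0 : \sum_i - \sum_(j | j \notin pblock Cs i) w i * w j * A i j = 0.
  apply/eqP; rewrite eq_le [X in _ && X]sumr_ge0 // andbT sumrN oppr_le0.
  by have := theta_slack fA; rewrite -/M S0 subrr !mulr0 subr0 add0r.
apply/matrixP => i j; rewrite A_starE.
have [<-|ne] := eqVneq i j; first by rewrite andbF dA.
rewrite andbT; case: ifP => [ij|/negbT ij].
  (* Inside a clique the vanishing distance reads [2 (k - 1) - 2 (A i j - 1) = 0]. *)
  have := psumr_eq0P (fun a _ => psd_dist2_ge0 i a pM) (spread0 i) (i := j) ij.
  rewrite /dist2 !mxE (negPf ne) !eqxx !dA mulr0n mulr1n; lra.
have := psumr_eq0P (fun i _ => row_ge0 i) cross0 (i := i) isT.
have ge0 b : b \notin pblock Cs i -> 0 <= - (w i * w b * A i b).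
  by move=> ib; rewrite oppr_ge0 mulr_ge0_le0 ?mulr_ge0 ?weight_ge0 ?Ax.
rewrite -sumrN => /(psumr_eq0P ge0) /(_ j ij) /eqP.
by rewrite oppr_eq0 !mulf_eq0 !(gt_eqF (weight_gt0 _)) //= => /eqP.
Qed.

(** * Size of the threshold, and edges under the planted law *)

Lemma cover_threshold_le : cover_threshold R Cs <= 100^-1.
Proof. by rewrite /cover_threshold ge_min lexx orbT. Qed.

(** For [k <= 1] the bound [1/100] suffices. For [k >= 2] the minimum of the inverse sizes is at
    most [1/k] of their sum, so [c <= 1 / (4 k^2)] and [c k <= 1 / (4 k) <= 1/8]. *)
Lemma cover_threshold_card : cover_threshold R Cs * k <= 8^-1.
Proof.
set c := cover_threshold R Cs.
have c100 : c <= 100^-1 := cover_threshold_le.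
have [k1|k2] := leqP #|Cs| 1.
  have : k <= 1 by rewrite (ler_nat R _ 1).
  have : 0 <= k by exact: ler0n.
  nra.
have {}k2 : 2 <= k by rewrite (ler_nat R 2).
pose m := \big[Num.min/1]_(C in Cs) (#|C|%:R^-1 : R).
pose T := \sum_(C in Cs) (#|C|%:R^-1 : R).
have m0 : 0 < m.
  rewrite /m; elim/big_ind: _ => // [x y x0 y0|C CC]; first by rewrite lt_min x0.
  by rewrite invr_gt0 card_block_gt0.
have mT : k * m <= T.
  by rewrite mulr_natl -sumr_const ler_sum // => C CC; apply: bigmin_le_cond.
have T0 : 0 < T by apply: lt_le_trans mT; nra.
have : c <= 4^-1 * (m / T) ^+ 2 by rewrite /c /cover_threshold ge_min lexx.
have : k * (m / T) <= 1 by rewrite mulrA ler_pdivrMr // mul1r.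
have : 0 <= m / T by rewrite divr_ge0 ?ltW.
set r := m / T => r0 kr cr.
have : (k * r) ^+ 2 <= 1 by rewrite expr_le1 // mulr_ge0 // ler0n.
nra.
Qed.

Lemma edge_prob_cross (p : R) i D j :
  D \in Cs -> i \notin D -> j \in D -> edge_prob Cs p [set i; j] = p.
Proof.
move=> DC iD jD; have ne : i != j by apply: contraNneq iD => ->.
rewrite /edge_prob cards2 ne /= ifN //; apply/existsP => -[C /andP[CC]].
rewrite subUset !sub1set => /andP[iC jC].
by move: iD; rewrite -(def_pblock trivCs DC jD) (def_pblock trivCs CC jC) iC.
Qed.

(** A pair inside a clique is an edge with probability 1, so its absence puts a factor 0 in the
    product. Graphs lacking such an edge can thus be ignored in the union bound. *)
Lemma planted_law_missing (p : R) (E : {set {set 'I_n}}) i j :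
  i != j -> j \in pblock Cs i -> [set i; j] \notin E -> planted_law Cs p E = 0.
Proof.
move=> ne ij ijE; rewrite /planted_law (bigD1 [set i; j]) //= (negPf ijE).
have -> : edge_prob Cs p [set i; j] = 1.
  rewrite /edge_prob cards2 ne /= ifT //; apply/existsP; exists (pblock Cs i).
  by rewrite own_block_in subUset !sub1set mem_own_block ij.
by rewrite subrr mul0r.
Qed.

End Cover.

(** * Total mass and generating functions of the planted law *)

Section PlantedLaw.

Context {R : realType} {n : nat} {Cs : {set {set 'I_n}}} {p : R}.
Hypothesis hp01 : 0 <= p <= 1.

Lemma planted_law_ge0 E : 0 <= planted_law Cs p E.
Proof.
apply: prodr_ge0 => e _; rewrite /edge_prob; case/andP: hp01 => p0 p1.
by case: (_ \in _); do 2?[case: ifP => _]; rewrite ?subr0 ?subrr ?subr_ge0.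
Qed.

Lemma sum_planted_law : \sum_E planted_law Cs p E = 1.
Proof.
have := planted_prob_sub Cs p set0; rewrite big_set0 => <-.
by apply: eq_bigl => E; rewrite sub0set asboolT.
Qed.

Lemma planted_prob_compl (Q : {set {set 'I_n}} -> Prop) :
  planted_prob Cs p Q = 1 - \sum_(E | ~~ `[< Q E >]) planted_law Cs p E.
Proof. by rewrite -sum_planted_law (bigID (fun E => `[< Q E >])) /= addrK. Qed.

(** This is the generating function of a binomial variable: by independence the expectation factors,
    with [p z + (1 - p)] for each pair in [S] and 1 for every other set. *)
Lemma planted_law_gen_fun (S : {set {set 'I_n}}) (z : R) :
  {in S, forall e, edge_prob Cs p e = p} ->
  \sum_E planted_law Cs p E * z ^+ #|S :&: E| = (1 + p * (z - 1)) ^+ #|S|.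
Proof.
move=> qS; pose X e := if e \in S then z else 1.
transitivity (\prod_e (edge_prob Cs p e * X e + (1 - edge_prob Cs p e))).
  rewrite bigA_distr; apply: eq_bigr => E _.
  have -> : z ^+ #|S :&: E| = \prod_e (if e \in E then X e else 1).
    rewrite -big_mkcond /= /X -big_mkcondr /= prodr_const.
    by congr (_ ^+ _); apply: eq_card => e; rewrite !inE andbC.
  by rewrite /planted_law -big_split /=; apply: eq_bigr => e _; case: ifP; rewrite ?mulr1.
rewrite (bigID (mem S)) /= [X in _ * X]big1 ?mulr1 => [|e /negPf eS]; last first.
  by rewrite /X eS mulr1 subrKC.
rewrite -prodr_const; apply: eq_bigr => e eS; rewrite qS // /X eS; ring.
Qed.

End PlantedLaw.

(** * A Chernoff bound for binomial tails *)

(** From [expR (- x) >= 1 - x] follows [expR x <= 1 / (1 - x)], and [(1 - x) (1 + x + 2 x^2) = 1 +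
    x^2 (1 - 2 x) >= 1]. *)
Lemma expR_le_quadratic (R : realType) (x : R) :
  0 <= x <= 2^-1 -> expR x <= 1 + x + 2 * x ^+ 2.
Proof.
case/andP=> x0 x1; have x1' : 0 < 1 - x by lra.
rewrite -(ler_pM2r x1'); apply: (@le_trans _ _ 1).
  have e0 := expR_gt0 x; rewrite mulrC -ler_pdivlMr // mul1r -expRN.
  exact: expR_ge1Dx.
have : 0 <= x ^+ 2 * (1 - 2 * x) by rewrite mulr_ge0 ?sqr_ge0 //; lra.
lra.
Qed.

(* With s = 4 (c - p), smallness of c leaves strict room in Hoeffding's bound,
   so that no calculus is needed. *)
Lemma bernoulli_chernoff (R : realType) (p c : R) (m : nat) :
  0 <= p < c -> c <= 100^-1 -> (0 < m)%N ->
  (1 + p * (expR (4 * (c - p)) - 1)) ^+ m * expR (- (4 * (c - p) * (c * m%:R)))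
    < expR (- 2 * m%:R * (c - p) ^+ 2).
Proof.
case/andP=> p0 pc c100 m0; set d := c - p.
have d0 : 0 < d by rewrite subr_gt0.
have hd : d <= 100^-1 by rewrite /d; lra.
rewrite expRN -ltr_pdivlMr ?invr_gt0 ?expR_gt0 // invrK -expRD.
have -> : - 2 * m%:R * d ^+ 2 + 4 * d * (c * m%:R) = m%:R * (4 * d * c - 2 * d ^+ 2).
  ring.
rewrite (expRM_natl m).
have e0 : 1 <= expR (4 * d) by rewrite -[leLHS]expR0 ler_expR; lra.
have b0 : 0 <= 1 + p * (expR (4 * d) - 1) by rewrite addr_ge0 // mulr_ge0 // subr_ge0.
rewrite ltr_pXn2r ?nnegrE ?expR_ge0 //.
apply: lt_le_trans (expR_ge1Dx _).
have : expR (4 * d) <= 1 + 4 * d + 2 * (4 * d) ^+ 2 by apply: expR_le_quadratic; lra.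
(* What remains is [p (4 d + 32 d^2) < 4 d (p + d) - 2 d^2], that is, [16 p < 1]. *)
have cE : c = p + d by rewrite /d; ring.
rewrite cE; nra.
Qed.

(** * Union bound over vertices and foreign cliques *)

Unset Implicit Arguments.

(* The inequality is strict as soon as there are two cliques; with a single
   clique the sum is empty and the lower bound 1 can only be attained. *)
Theorem mainTheorem1 (R : realType) (n : nat) (Cs : {set {set 'I_n}}) (p : R)
    (hCs : partition Cs [set: 'I_n])
    (hp01 : 0 <= p <= 1)
    (hp : p < cover_threshold R Cs) :
  1 - \sum_(C in Cs) #|C|%:R *
        \sum_(D in Cs | D != C)
          expR (- 2 * #|D|%:R * (cover_threshold R Cs - p) ^+ 2)
  < planted_prob Cs p (fun E => theta_unique_optimal E #|Cs|%:R (A_star R Cs))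
  ?<= if (#|Cs| == 1%N).
Proof.
set c := cover_threshold R Cs in hp *.
have c100 : c <= 100^-1 := cover_threshold_le.
have [p0 p1] := andP hp01; have c0 : 0 < c by apply: le_lt_trans hp.
have trivCs : trivIset Cs by case/and3P: hCs.
(* For an empty cover the threshold is 0, because the quotient by the empty sum is 0. *)
have Cs0 : (0 < #|Cs|)%N.
  rewrite lt0n; apply/eqP => /cards0_eq C0; move: c0.
  by rewrite /c /cover_threshold C0 !big_set0 invr0 mulr0 expr0n mulr0 lt_min ltxx.
pose S i (D : {set 'I_n}) := [set [set i; j] | j in D].
pose s := 4 * (c - p).
(* The exponential Markov weight: [expR s] to the number of neighbours of [i] in [D], normalised to
   be at least 1 when that number exceeds [c * #|D|]. *)
pose G E i D := expR s ^+ #|S i D :&: E| * expR (- (s * (c * #|D|%:R))).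
have pair_inj i (D : {set 'I_n}) :
    i \notin D -> {in D &, injective (fun j => [set i; j])}.
  move=> iD j j' jD j'D /setP /(_ j); rewrite !inE eqxx orbT => /esym /orP[]/eqP // ji.
  by rewrite -ji jD in iD.
have cardS i (D : {set 'I_n}) : i \notin D -> #|S i D| = #|D|.
  by move=> iD; rewrite card_in_imset //; apply: pair_inj.
have cardSE i (D : {set 'I_n}) (E : {set {set 'I_n}}) : i \notin D ->
    #|[set j in D | [set i; j] \in E]| = #|S i D :&: E|.
  move=> iD; rewrite -(card_in_imset (f := fun j => [set i; j])); last first.
    by move=> j j'; rewrite !inE => /andP[jD _] /andP[j'D _]; exact: (pair_inj i D iD).
  congr #|pred_of_set _|; apply/setP => e; rewrite inE; apply/imsetP/andP.
    by case=> j; rewrite inE => /andP[jD jE] ->; split=> //; apply: imset_f.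
  by case=> /imsetP[j jD ->] jE; exists j; rewrite // inE jD.
pose mgf (D : {set 'I_n}) :=
  (1 + p * (expR s - 1)) ^+ #|D| * expR (- (s * (c * #|D|%:R))).
have EG i D : D \in Cs -> i \notin D -> \sum_E planted_law Cs p E * G E i D = mgf D.
  move=> DC iD; rewrite /mgf -(cardS i D iD) -(planted_law_gen_fun (Cs := Cs)).
    by rewrite mulr_suml; apply: eq_bigr => E _; rewrite /G mulrA (cardS _ _ iD).
  by move=> _ /imsetP[j jD ->]; apply: (edge_prob_cross hCs) DC iD jD.
have G0 E i D : 0 <= G E i D by rewrite mulr_ge0 ?exprn_ge0 ?expR_ge0.
have fail_le :
    \sum_(E | ~~ `[< theta_unique_optimal E #|Cs|%:R (A_star R Cs) >])
      planted_law Cs p E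
    <= \sum_(C in Cs) #|C|%:R * \sum_(D in Cs | D != C) mgf D.
  (* The bound is the expectation of the sum of all [G E i D], so it is enough that this sum is at
     least 1 on failing graphs of nonzero mass. *)
  have -> : \sum_(C in Cs) #|C|%:R * \sum_(D in Cs | D != C) mgf D
     = \sum_E planted_law Cs p E *
         \sum_(C in Cs) \sum_(i in C) \sum_(D in Cs | D != C) G E i D.
    under [RHS]eq_bigr do rewrite mulr_sumr.
    rewrite exchange_big; apply: eq_bigr => C CC /=.
    under [RHS]eq_bigr do rewrite mulr_sumr.
    rewrite exchange_big mulr_natl -sumr_const; apply: eq_bigr => i iC /=.
    under [RHS]eq_bigr do rewrite mulr_sumr.
    rewrite exchange_big; apply: eq_bigr => D /andP[DC DneC] /=.
    rewrite EG //; apply: contra DneC => iD.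
    by rewrite -(def_pblock trivCs DC iD) (def_pblock trivCs CC iC).
  have sum0 E : 0 <= \sum_(C in Cs) \sum_(i in C) \sum_(D in Cs | D != C) G E i D.
    by do 3![apply: sumr_ge0 => ? _].
  rewrite big_mkcond ler_sum //= => E _; case: ifP => [/asboolPn nQ|_]; last first.
    by rewrite mulr_ge0 ?planted_law_ge0.
  have [->|law0] := eqVneq (planted_law Cs p E) 0; first by rewrite mul0r.
  rewrite ler_peMr ?planted_law_ge0 //.
  (* Nonzero mass means that all edges inside cliques are present, so a failure of unique optimality
     must come from a failure of sparsity. *)
  have [i [D [DC iD bad]]] : exists i D, [/\ D \in Cs, i \notin D &
      c * #|D|%:R < #|[set j in D | [set i; j] \in E]|%:R].
    apply: contrapT => good; apply: nQ.
    apply: (@sparse_cover_unique_optimal _ _ _ hCs _ c) => //.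
    - by move=> i j ne ij; apply: contraNT law0 => /(planted_law_missing hCs p ne ij) ->.
    - move=> i D DC iD; rewrite leNgt; apply/negP => lt.
      by apply: good; exists i, D.
    - by rewrite (ltW c0).
    - exact: (cover_threshold_card hCs).
  (* The term of the bad pair [i], [D] is isolated from the triple sum; it alone is at least 1, and
     the others are nonnegative. *)
  rewrite (bigD1 (pblock Cs i)) ?(own_block_in hCs) //=.
  rewrite (bigD1 i) ?(mem_own_block hCs) //= (bigD1 D) /=; last first.
    by rewrite DC; apply: contraNneq iD => ->; apply: (mem_own_block hCs).
  have G1 : 1 <= G E i D.
    rewrite /G -expRM_natl -expRD -[leLHS]expR0 ler_expR -cardSE //.
    have s0 : 0 < s by rewrite /s; lra.
    by rewrite mulrC -mulrBr mulr_ge0 ?(ltW s0) // subr_ge0 ltW.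
  rewrite -!addrA; apply: (le_trans G1); rewrite lerDl !addr_ge0 //.
  - by apply: sumr_ge0.
  - by do 2![apply: sumr_ge0 => ? _].
  - by do 3![apply: sumr_ge0 => ? _].
rewrite planted_prob_compl.
have mgf_lt D : D \in Cs -> mgf D < expR (- 2 * #|D|%:R * (c - p) ^+ 2).
  move=> DC; apply: bernoulli_chernoff => //; first by rewrite p0.
  by rewrite -(ltr0n R); apply: (card_block_gt0 hCs).
have [k1|k1] := eqVneq #|Cs| 1%N.
  rewrite /= lerD2l lerN2; apply: le_trans fail_le _.
  apply: ler_sum => C CC; rewrite ler_wpM2l ?ler0n // ler_sum // => D /andP[DC _].
  exact/ltW/mgf_lt.
rewrite /= ltrD2l ltrN2; apply: le_lt_trans fail_le _.
apply: ltr_sum => [|C CC].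
  by have /card_gt0P [C CC] := Cs0; apply/hasP; exists C; rewrite ?mem_index_enum.
rewrite ltr_pM2l ?(card_block_gt0 hCs) //.
apply: ltr_sum => [|D /andP[DC _]]; last exact: mgf_lt.
(* Strictness of the inner sum requires one nonempty index range: a second clique [D] besides
   [C]. *)
have /card_gt0P [D] : (0 < #|Cs :\ C|)%N.
  by move: k1 Cs0; rewrite (cardsD1 C) CC; case: #|_|.
rewrite !inE => /andP[DneC DC]; apply/hasP; exists D; rewrite ?mem_index_enum //.
by rewrite DC.
Qed.
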